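(* Let $n\ge p$, $\mathcal X\in\mathrm{St}(n,p,l)$, $\mathcal U,\mathcal V\in T_{\mathcal X}\mathrm{St}(n,p,l)$, and let $R_{\mathcal X}(\mathcal U)=qf(\mathcal X+\mathcal U)$ be the t-QR based retraction. Put $\mathcal Q=R_{\mathcal X}(\mathcal U)$, $\mathcal C=\mathcal V*(\mathcal Q^\top*(\mathcal X+\mathcal U))^{-1}$, $\mathcal B=\mathcal Q^\top*\mathcal C$, and $\hat B^{(i)}=(L(\mathcal B))^{(i)}$. Then the vector transport by differentiated retraction $\mathcal T_{\mathcal U}\mathcal V:=\frac{d}{dt}R_{\mathcal X}(\mathcal U+t\mathcal V)\big|_{t=0}$ equals $$\mathcal T_{\mathcal U}\mathcal V=\mathcal Q*L^{-1}\Big(\text{the tensor with frontal slices }\mathbf P_{\mathrm{skew}}(\hat B^{(i)}),\ i=1,\dots,l\Big)+(\mathcal I-\mathcal Q*\mathcal Q^\top)*\mathcal C,$$ where for a complex $p\times p$ matrix $B$, $\mathbf P_{\mathrm{skew}}(B)$ is the skew-Hermitian matrix $S$ such that $B-S$ is upper triangular with real diagonal; explicitly $S_{mn}=B_{mn}$ for $m>n$, $S_{mm}=\mathrm i\,\operatorname{Im}(B_{mm})$, and $S_{mn}=-\overline{B_{nm}}$ for $m<n$.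
   Context: Frontal slices $A^{(i)}=\mathcal A(:,:,i)$. The t-product is $\mathcal A*\mathcal B=\operatorname{fold}(\operatorname{bcirc}(\mathcal A)\operatorname{unfold}(\mathcal B))$, where $\operatorname{bcirc}(\mathcal A)$ is the block circulant matrix with $(i,j)$ block $A^{(((i-j)\bmod l)+1)}$, $\operatorname{unfold}$ stacks frontal slices vertically, $\operatorname{fold}$ is its inverse. Transpose: $\mathcal A^\top$ has frontal slices $(A^{(1)})^\top,(A^{(l)})^\top,\dots,(A^{(2)})^\top$. $\mathcal I$ identity tensor; $\mathcal A^{-1}$ the t-product inverse. The DFT $L(\mathcal A)=\hat{\mathcal A}$ has frontal slices $\hat A^{(k)}=\sum_{j=1}^l\omega^{(k-1)(j-1)}A^{(j)}$, $\omega=e^{-2\pi\mathrm i/l}$, $L^{-1}$ its inverse; $\mathcal C=\mathcal A*\mathcal B$ iff $\hat C^{(k)}=\hat A^{(k)}\hat B^{(k)}$. $\mathrm{St}(n,p,l)=\{\mathcal X\in\mathbb R^{n\times p\times l}:\mathcal X^\top*\mathcal X=\mathcal I\}$. For $\mathcal A$ whose DFT slices all have full column rank $p$, $qf(\mathcal A)$ is the factor $\mathcal Q\in\mathrm{St}(n,p,l)$ of the unique t-QR decomposition $\mathcal A=\mathcal Q*\mathcal R$ in which the DFT slices of $\mathcal R$ are upper triangular with real strictly positive diagonal. *)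

(* Defs.v *)
From HB Require Import structures.
From mathcomp Require Import all_boot all_order all_algebra.
From mathcomp Require Import all_classical all_reals all_analysis.
From mathcomp Require Import complex.
Set Implicit Arguments.
Unset Strict Implicit.
Unset Printing Implicit Defensive.
Import Order.TTheory GRing.Theory Num.Theory.
Local Open Scope ring_scope.

(* A third-order tensor of size n x p x l, given by its frontal slices,
   indexed 0 .. l-1 (slice k here is A^(k+1) in the paper). *)
Definition tensor (T : Type) (n p l : nat) := 'I_l -> 'M[T]_(n, p).

Lemma ord_pos (l : nat) (i : 'I_l) : (0 < l)%N.
Proof. exact: leq_ltn_trans (leq0n i) (ltn_ord i). Qed.

Definition ord_sub (l : nat) (i j : 'I_l) : 'I_l :=
  Ordinal (ltn_pmod (i + l - j)%N (ord_pos i)).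
Definition ord_neg (l : nat) (i : 'I_l) : 'I_l :=
  Ordinal (ltn_pmod (l - i)%N (ord_pos i)).

Section TensorOps.
Variable K : pzRingType.

Definition tadd n p l (A B : tensor K n p l) : tensor K n p l :=
  fun k => A k + B k.
Definition tsub n p l (A B : tensor K n p l) : tensor K n p l :=
  fun k => A k - B k.
Definition tscale n p l (a : K) (A : tensor K n p l) : tensor K n p l :=
  fun k => a *: A k.

(* t-product: fold(bcirc(A) unfold(B)); block row k of bcirc(A) is
   [A^((k-j) mod l)]_j, so slice k of A*B is sum_j A^((k-j) mod l) B^(j). *)
Definition tprod n p q l (A : tensor K n p l) (B : tensor K p q l)
  : tensor K n q l :=
  fun k => \sum_(j < l) A (ord_sub k j) *m B j.

Definition ttr n p l (A : tensor K n p l) : tensor K p n l :=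
  fun k => (A (ord_neg k))^T.

Definition tid n l : tensor K n n l :=
  fun k => if nat_of_ord k == 0%N then 1%:M else 0.

End TensorOps.

Definition tinv (K : pzRingType) p l (A : tensor K p p l) : tensor K p p l :=
  match pselect (exists B, tprod A B = @tid K p l /\ tprod B A = @tid K p l) with
  | left e => proj1_sig (cid e)
  | right _ => A
  end.

Definition tStiefel (R : realType) n p l (X : tensor R n p l) : Prop :=
  tprod (ttr X) X = @tid R p l.

Definition tTangent (R : realType) n p l (X U : tensor R n p l) : Prop :=
  tadd (tprod (ttr X) U) (tprod (ttr U) X) = (fun _ => 0).

Definition tlift (R : realType) n p l (A : tensor R n p l) : tensor (complex R) n p l :=
  fun k => map_mx (fun x => Complex x 0) (A k).

Definition omega (R : realType) (l : nat) : (complex R) :=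
  Complex (cos (2 * pi / l%:R)) (- sin (2 * pi / l%:R)).

Definition tdft (R : realType) n p l (A : tensor (complex R) n p l) : tensor (complex R) n p l :=
  fun k => \sum_(j < l) (omega R l ^+ (k * j)) *: A j.

Definition tidft (R : realType) n p l (A : tensor (complex R) n p l) : tensor (complex R) n p l :=
  fun j => (l%:R)^-1 *: \sum_(k < l) (omega R l ^+ (k * j))^-1 *: A k.

Definition upper_pos_diag (R : realType) p (M : 'M[(complex R)]_p) : Prop :=
  (forall a b : 'I_p, (b < a)%N -> M a b = 0) /\
  (forall a : 'I_p, complex.Im (M a a) = 0 /\ 0 < complex.Re (M a a)).

Definition is_tQR (R : realType) n p l (A Q : tensor R n p l)
  (Rt : tensor R p p l) : Prop :=
  tStiefel Q /\ A = tprod Q Rt /\ forall k, upper_pos_diag (tdft (tlift Rt) k).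

(* qf(A): the Q factor of the (unique) t-QR decomposition *)
Definition qf (R : realType) n p l (A : tensor R n p l) : tensor R n p l :=
  match pselect (exists Q, exists Rt, is_tQR A Q Rt) with
  | left e => proj1_sig (cid e)
  | right _ => A
  end.

Definition Pskew (R : realType) p (B : 'M[(complex R)]_p) : 'M[(complex R)]_p :=
  \matrix_(a, b) if (b < a)%N then B a b
                 else if a == b then Complex 0 (complex.Im (B a a))
                 else - conjc (B b a).

(* Main.v *)
Require Import Defs.
From HB Require Import structures.
From mathcomp Require Import all_boot all_order all_algebra.
From mathcomp Require Import all_classical all_reals all_analysis.
From mathcomp Require Import complex spectral.
From mathcomp Require Import ring lra zify.
Import Order.TTheory GRing.Theory Num.Theory.
Import numFieldNormedType.Exports.
Local Open Scope ring_scope.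
Local Open Scope sesquilinear_scope.
Set Implicit Arguments.
Unset Strict Implicit.
Unset Printing Implicit Defensive.

(** The DFT turns the t-product into slicewise products of complex matrices, and
    the transpose of a real tensor into the slicewise adjoint.  Slicewise QR exists
    because [(X + W)^* (X + W) = 1 + W^* W] for [W] tangent at [X]; it is unique,
    hence compatible with conjugation, so the factors come from real tensors.
    With [R0] the R-factor of [X + U], the factors of [X + U + t V] satisfy
    [Q(t) S(t) = Q + t C] where [S(t) = R(t) R0^-1] is upper triangular with
    positive diagonal, and [S(t)^* S(t) = 1 + t (B + B^* ) + O(t^2)].  Expanding to
    first order, row by row for [S] and then column by column for [Q], gives
    [S'(0) = B - Pskew B] and [Q'(0) = C - Q (B - Pskew B)].  The expansion of the
    real tensor [Q(t)] is recovered by the inverse DFT; since its values are real,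
    so is its derivative. *)

(** * QR factorization of complex matrices *)

Section ComplexMatrices.
Variable C : numClosedFieldType.
Implicit Types n p q : nat.

(** In a [numClosedFieldType], [0 < z] already forces [z] to be real, so this encodes a real
    strictly positive diagonal. *)
Definition upper_pos p (M : 'M[C]_p) : Prop :=
  (forall a b : 'I_p, (b < a)%N -> M a b = 0) /\ (forall a, 0 < M a a).

Lemma adjmxM n p q (A : 'M[C]_(n, p)) (B : 'M[C]_(p, q)) :
  (A *m B)^t* = B^t* *m A^t*.
Proof. by rewrite trmx_mul map_mxM. Qed.

Lemma adjmxK n p (A : 'M[C]_(n, p)) : A^t*^t* = A.
Proof. by apply/matrixP=> i j; rewrite !mxE conjCK. Qed.

Lemma adjmxD n p (A B : 'M[C]_(n, p)) : (A + B)^t* = A^t* + B^t*.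
Proof. by apply/matrixP=> i j; rewrite !mxE rmorphD. Qed.

Lemma gramE n p (S : 'M[C]_(n, p)) a b :
  (S^t* *m S) a b = \sum_c Num.conj (S c a) * S c b.
Proof. by rewrite mxE; apply: eq_bigr => c _; rewrite !mxE. Qed.

Lemma upper_unit p (M : 'M[C]_p) : upper_pos M -> M \in unitmx.
Proof.
move=> [Mu Mp]; rewrite unitmxE -det_tr det_trig; last first.
  by apply/is_trig_mxP => i j ij; rewrite mxE Mu.
by rewrite unitfE; apply/prodf_neq0 => i _; rewrite mxE gt_eqF.
Qed.

(** Row [a] of the Gram matrix involves only row [a] of [S] and the rows before it, since [S c a]
    vanishes for [c > a]. The inductions on rows below rest on this. *)
Lemma upper_gramE p (S : 'M[C]_p) (a b : 'I_p) : upper_pos S ->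
  (S^t* *m S) a b = S a a * S a b + \sum_(c < p | (c < a)%N) Num.conj (S c a) * S c b.
Proof.
move=> [Su Sp]; rewrite gramE (bigD1 a) //= (CrealP _) ?gtr0_real //.
congr (_ + _); rewrite (bigID (fun c : 'I_p => (c < a)%N)) /=.
rewrite [X in _ + X]big1 ?addr0 => [|c /andP[ca]]; last first.
  rewrite -leqNgt leq_eqVlt => /orP[/eqP/val_inj e|/Su ->].
    by rewrite -e eqxx in ca.
  by rewrite rmorph0 mul0r.
apply: eq_bigl => c; case: ltnP => [|_]; rewrite ?andbF // andbT.
by move=> ca; rewrite -val_eqE ltn_eqF.
Qed.

(** Induction on rows: once the earlier rows agree, [upper_gramE] determines [S a a * S a b]. Taking
    [b = a] gives the square of a positive number, hence the diagonal entry, by which one then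
    divides. *)
Lemma cholesky_uniq p (S T : 'M[C]_p) : upper_pos S -> upper_pos T ->
  S^t* *m S = T^t* *m T -> S = T.
Proof.
move=> uS uT e; apply/matrixP.
suff H m : forall a b : 'I_p, (a < m)%N -> S a b = T a b.
  by move=> a b; exact: (H a.+1).
elim: m => // m IH a b; rewrite ltnS => am.
have E c : S a a * S a c = T a a * T a c.
  move/matrixP/(_ a c): e; rewrite !upper_gramE //.
  rewrite (eq_bigr (fun d => Num.conj (T d a) * T d c)); first by move/addIr.
  by move=> d da; rewrite !IH // (leq_trans da).
have [[_ Sp] [_ Tp]] := (uS, uT).
have Ea : S a a = T a a.
  move: (E a); rewrite -!expr2 => /eqP; rewrite eqrXn2 ?ltW // => /eqP //.
by move: (E b); rewrite Ea => /mulfI -> //; rewrite gt_eqF.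
Qed.

Lemma isometry_gram n p q (Q : 'M[C]_(n, p)) (S : 'M[C]_(p, q)) :
  Q^t* *m Q = 1%:M -> (Q *m S)^t* *m (Q *m S) = S^t* *m S.
Proof. by move=> Q1; rewrite adjmxM mulmxA -(mulmxA (S^t*)) Q1 mulmx1. Qed.

Lemma qr_uniq n p (Q Q' : 'M[C]_(n, p)) (S S' : 'M[C]_p) :
  Q^t* *m Q = 1%:M -> Q'^t* *m Q' = 1%:M -> upper_pos S -> upper_pos S' ->
  Q *m S = Q' *m S' -> Q = Q' /\ S = S'.
Proof.
move=> Q1 Q1' uS uS' e.
have eS : S = S'.
  by apply: cholesky_uniq => //; rewrite -(isometry_gram S Q1) e isometry_gram.
split=> //; rewrite -eS in e.
by rewrite -[Q](mulmxK (upper_unit uS)) e mulmxK ?upper_unit.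
Qed.


Lemma gram_row_eq0 p (u : 'rV[C]_p) : (u *m u^t*) 0 0 = 0 -> u = 0.
Proof.
rewrite mxE => /eqP; rewrite psumr_eq0 => [/allP H|i _]; last first.
  by rewrite !mxE mul_conjC_ge0.
apply/rowP => i; move: (H i); rewrite mem_index_enum => /(_ isT) /=.
by rewrite !mxE mul_conjC_eq0 => /eqP.
Qed.

Lemma gram_row_ge0 p (u : 'rV[C]_p) : 0 <= (u *m u^t*) 0 0.
Proof. by rewrite mxE; apply: sumr_ge0 => i _; rewrite !mxE mul_conjC_ge0. Qed.

(** If a row [u] is in the kernel, multiplying by its adjoint gives $|u|^2 + |uA^*|^2 = 0$, a sum of
    two nonnegative terms. *)
Lemma add1_gram_unit n p (A : 'M[C]_(n, p)) : 1%:M + A^t* *m A \in unitmx.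
Proof.
rewrite -row_free_unit; apply/inj_row_free => u uA.
apply: gram_row_eq0.
have : u *m u^t* + (u *m A^t*) *m (u *m A^t*)^t* = 0.
  transitivity (u *m (1%:M + A^t* *m A) *m u^t*); last by rewrite uA mul0mx.
  by rewrite mulmxDr mulmx1 mulmxDl adjmxM adjmxK !mulmxA.
move=> /matrixP/(_ 0 0)/eqP; rewrite mxE [X in _ == X]mxE.
by rewrite paddr_eq0 ?gram_row_ge0 // => /andP[/eqP].
Qed.

(* Gram-Schmidt on the rows of [M^t*], i.e. [M^t* = L W] with [W] unitary, gives [Q = W^t*]. *)
Lemma qr_exists n p (M : 'M[C]_(n, p)) : (p <= n)%N -> M^t* *m M \in unitmx ->
  exists (Q : 'M[C]_(n, p)) (S : 'M[C]_p),
    [/\ Q^t* *m Q = 1%:M, upper_pos S & M = Q *m S].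
Proof.
move=> pn Mu; pose W := schmidt (M^t*).
have W1 : W *m W^t* = 1%:M by apply/unitarymxP; exact: schmidt_unitarymx.
have MW : M = W^t* *m (W *m M).
  have /submxP[L e] := schmidt_sub (M^t*).
  have -> : M = W^t* *m L^t* by rewrite -adjmxM -e adjmxK.
  by rewrite (mulmxA W) W1 mul1mx.
(* Row [b] of the adjoint of [M] lies in the span of rows [0..b] of [W], all orthogonal to row [a]
   when [b < a]. *)
have tri (a b : 'I_p) : (b < a)%N -> (W *m M) a b = 0.
  move=> ba; have /sub_sumsmxP[u e] := row_schmidt_sub (M^t*) b.
  have -> : (W *m M) a b = Num.conj ((row b (M^t*) *m W^t*) 0 a).
    rewrite !mxE rmorph_sum; apply: eq_bigr => c _.
    by rewrite !mxE rmorphM /= !conjCK mulrC.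
  rewrite e mulmx_suml summxE big1 ?rmorph0 // => c cb.
  have /submxP[x ->] : (u c *m <<row c W>> <= row c W)%MS.
    by rewrite (submx_trans (submxMl _ _)) ?genmxE.
  rewrite -mulmxA -row_mul W1 !mxE big1 // => d _.
  rewrite !mxE; case: eqP => [ca|]; rewrite ?mulr0 //.
  by move: ba; rewrite -ca ltnNge cb.
have dge0 a : 0 <= (W *m M) a a.
  have := form1_row_schmidt (M^t*) a; rewrite -/W dotmxE.
  suff <- : Num.conj ((row a (M^t*) *m (row a W)^t*) 0 0) = (W *m M) a a.
    by rewrite conjC_ge0.
  rewrite !mxE rmorph_sum; apply: eq_bigr => c _.
  by rewrite !mxE rmorphM /= !conjCK mulrC.
exists (W^t*), (W *m M); rewrite adjmxK; split=> //; split=> // a.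
rewrite lt_def dge0 andbT.
(* Strict positivity: [W *m M] has the invertible Gram matrix of [M], so its triangular determinant
   has no zero factor. *)
have : W *m M \in unitmx.
  have : (W *m M)^t* *m (W *m M) \in unitmx.
    by rewrite adjmxM -mulmxA -MW.
  by rewrite unitmx_mul => /andP[].
rewrite unitmxE -det_tr det_trig; last first.
  by apply/is_trig_mxP => i j ij; rewrite mxE tri.
by rewrite unitfE => /prodf_neq0/(_ a isT); rewrite mxE.
Qed.

Lemma mul_upperE n p (A : 'M[C]_(n, p)) (T : 'M[C]_p) a b :
  (forall a b : 'I_p, (b < a)%N -> T a b = 0) ->
  (A *m T) a b = A a b * T b b + \sum_(c < p | (c < b)%N) A a c * T c b.
Proof.
move=> Tu; rewrite mxE (bigD1 b) //=; congr (_ + _).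
rewrite (bigID (fun c : 'I_p => (c < b)%N)) /= [X in _ + X]big1 ?addr0.
  apply: eq_bigl => c; case: ltnP => [|_]; rewrite ?andbF // andbT.
  by move=> cb; rewrite -val_eqE ltn_eqF.
move=> c /andP[cb]; rewrite -leqNgt leq_eqVlt => /orP[/eqP/val_inj e'|/Tu ->].
  by rewrite e' eqxx in cb.
by rewrite mulr0.
Qed.

(** Induction on columns: below the diagonal, [mul_upperE] leaves only [S a b * T b b = 0]; on the
    diagonal it gives [Z a a = S a a * T a a]. *)
Lemma upper_pos_divr p (S T Z : 'M[C]_p) :
  upper_pos T -> upper_pos Z -> S *m T = Z -> upper_pos S.
Proof.
move=> [Tu Tp] [Zu Zp] e.
have E a b := mul_upperE S a b Tu.
rewrite e in E.
have Su m : forall a b : 'I_p, (b < m)%N -> (b < a)%N -> S a b = 0.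
  elim: m => // m IH a b; rewrite ltnS => bm ba.
  have := E a b; rewrite Zu // big1 ?addr0; last first.
    by move=> c cb; rewrite IH ?mul0r ?(leq_trans cb bm) ?(ltn_trans cb ba).
  by move=> /esym/eqP; rewrite mulf_eq0 (gt_eqF (Tp b)) orbF => /eqP.
have Su' (a b : 'I_p) : (b < a)%N -> S a b = 0 by exact: (Su b.+1).
split=> // a; have := Zp a; rewrite E big1 ?addr0 ?pmulr_lgt0 //.
by move=> c ca; rewrite Su' // mul0r.
Qed.

End ComplexMatrices.

(** * The tensor DFT *)

Section RootOfUnity.
Variable R : realType.

Lemma conjcE (z : complex R) : conjc z = Num.conj z.
Proof. by []. Qed.

Lemma omegaX l m : omega R l ^+ m =
  Complex (cos (m%:R * (2 * pi / l%:R))) (- sin (m%:R * (2 * pi / l%:R))).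
Proof.
elim: m => [|m IH]; first by rewrite expr0 mul0r cos0 sin0 oppr0.
rewrite exprSr IH /omega -[m.+1%:R]natr1; move: (2 * pi / l%:R) => x.
rewrite mulrDl mul1r cosD sinD.
by congr Complex; ring.
Qed.

Lemma omega_l l : (0 < l)%N -> omega R l ^+ l = 1.
Proof.
move=> l0; rewrite omegaX mulrCA divff ?mulr1 ?pnatr_eq0 -?lt0n //.
by rewrite mulr_natl cos2pi sin2pi oppr0.
Qed.

(** With half the angle, $x = m\pi/l$ in $(0,\pi)$, $\cos 2x = 1$ would force $\sin x = 0$. *)
Lemma omega_neq1 l m : (0 < m < l)%N -> omega R l ^+ m != 1.
Proof.
move=> /andP[m0 ml]; rewrite omegaX; apply/eqP => -[c1 _].
have l0 : (0 : R) < l%:R by rewrite ltr0n (leq_trans _ ml).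
set x := m%:R * (pi / l%:R) : R.
have x0 : 0 < x by apply: mulr_gt0; rewrite ?ltr0n // divr_gt0 ?pi_gt0.
have xpi : x < pi.
  by rewrite /x mulrCA gtr_pMr ?pi_gt0 // ltr_pdivrMr // mul1r ltr_nat.
move: c1; have -> : m%:R * (2 * pi / l%:R) = x *+ 2.
  by rewrite -[x *+ 2]mulr_natl -(mulrA 2) mulrCA.
have s0 : 0 < sin x by rewrite sin_gt0_pi // x0.
rewrite cos_mulr2n => h; have h' := cos2Dsin2 x.
have : sin x ^+ 2 = 0 by lra.
by move/eqP; rewrite sqrf_eq0 gt_eqF.
Qed.

Lemma omega_conj l m : (0 < l)%N ->
  conjc (omega R l ^+ m) = (omega R l ^+ m)^-1.
Proof.
move=> l0; have w1 : omega R l * conjc (omega R l) = 1.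
  rewrite /omega; move: (2 * pi / l%:R) => x; have := cos2Dsin2 x.
  move: (cos x) (sin x) => c s cs; apply/eqP; rewrite eq_complex /=.
  by apply/andP; split; apply/eqP; rewrite -?cs; ring.
have wu : omega R l != 0.
  by apply/eqP => w0; move: w1; rewrite w0 mul0r => /esym/eqP; rewrite oner_eq0.
rewrite rmorphXn -exprVn; congr (_ ^+ _).
by apply: (mulfI wu); rewrite w1 divff.
Qed.

Lemma omega_neq0 l m : (0 < l)%N -> omega R l ^+ m != 0.
Proof.
move=> l0; apply/expf_neq0/eqP => w0.
by have := omega_l l0; rewrite w0 expr0n eqn0Ngt l0 => /esym/eqP; rewrite oner_eq0.
Qed.

Lemma omega_neg l m (j : 'I_l) : omega R l ^+ (m * ord_neg j) = (omega R l ^+ (m * j))^-1.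
Proof.
have l0 := ord_pos j; apply: (mulIf (omega_neq0 (m * j) l0)).
rewrite mulVf ?omega_neq0 // -exprD -mulnDr mulnC exprM /=.
have -> : omega R l ^+ ((l - j) %% l + j) = 1; last by rewrite expr1n.
rewrite -(expr_mod _ (omega_l l0)) modnDml subnK ?modnn //.
exact: ltnW (ltn_ord j).
Qed.

Lemma omega_sum l (i j : 'I_l) :
  \sum_(k < l) omega R l ^+ (k * i) / omega R l ^+ (k * j) =
  if i == j then l%:R else 0.
Proof.
have l0 := ord_pos i.
(* The sum is geometric with ratio [z]; for [i != j], [z ^+ l = 1] and [z != 1] make it vanish. *)
pose z := omega R l ^+ i / omega R l ^+ j.
have -> : \sum_(k < l) omega R l ^+ (k * i) / omega R l ^+ (k * j) =
          \sum_(k < l) z ^+ k.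
  by apply: eq_bigr => k _; rewrite /z expr_div_n -!exprM ![(k * _)%N]mulnC.
case: eqP => [ij|ij].
  rewrite (eq_bigr (fun=> 1)) ?sumr_const ?card_ord // => k _.
  by rewrite /z ij divff ?omega_neq0 // expr1n.
have zl : z ^+ l = 1.
  by rewrite /z expr_div_n -!exprM ![(_ * l)%N]mulnC !exprM omega_l // !expr1n divr1.
have zn1 : z != 1.
  apply/eqP => z1.
  have e : omega R l ^+ i = omega R l ^+ j.
    by rewrite -[LHS](divfK (omega_neq0 j l0)) -/z z1 mul1r.
  wlog ltij : i j ij {z zl z1} e / (i < j)%N.
    move=> H; case: (ltngtP i j) => h.
    - exact: H ij e h.
    - by apply: (H j i) => //; exact/nesym.
    - by apply: ij; apply: val_inj.
  have : omega R l ^+ (j - i) != 1.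
    by apply: omega_neq1; rewrite subn_gt0 ltij (leq_ltn_trans (leq_subr _ _)).
  by rewrite expfB // e divff ?omega_neq0 // eqxx.
have := subrX1 z l; rewrite zl subrr => /esym/eqP.
by rewrite mulf_eq0 subr_eq0 (negbTE zn1) => /eqP.
Qed.

End RootOfUnity.

(** * Inversion of the DFT, its action on products and transposes, and the image of the real
    tensors *)

Section Fourier.
Variable R : realType.
Implicit Types n p q l : nat.

Lemma tensorP (T : Type) n p l (A B : tensor T n p l) :
  (forall k a b, A k a b = B k a b) -> A = B.
Proof. by move=> e; apply/funext => k; apply/matrixP => a b. Qed.

Lemma natrl_neq0 l (k : 'I_l) : (l%:R : complex R) != 0.
Proof. by rewrite pnatr_eq0 -lt0n (ord_pos k). Qed.

Lemma tdftK n p l : cancel (@tdft R n p l) (@tidft R n p l).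
Proof.
move=> A; apply/funext => j; rewrite /tidft /tdft.
under eq_bigr do rewrite scaler_sumr.
rewrite exchange_big /= (bigD1 j) //= [X in _ + X]big1 ?addr0.
  under eq_bigr do rewrite scalerA mulrC.
  by rewrite -scaler_suml omega_sum eqxx scalerA mulVf ?scale1r // (natrl_neq0 j).
move=> i ij; under eq_bigr do rewrite scalerA mulrC.
by rewrite -scaler_suml omega_sum (negbTE ij) scale0r.
Qed.

Lemma tidftK n p l : cancel (@tidft R n p l) (@tdft R n p l).
Proof.
move=> A; apply/funext => j; rewrite /tidft /tdft.
under eq_bigr do rewrite scalerA mulrC -scalerA scaler_sumr.
rewrite -scaler_sumr exchange_big /= (bigD1 j) //= [X in _ + X]big1 ?addr0.
  under eq_bigr do rewrite scalerA (mulnC j).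
  by rewrite -scaler_suml omega_sum eqxx scalerA mulVf ?scale1r // (natrl_neq0 j).
move=> i ij; under eq_bigr do rewrite scalerA (mulnC j) (mulnC i).
by rewrite -scaler_suml omega_sum eq_sym (negbTE ij) scale0r.
Qed.

Lemma tdft_inj n p l : injective (@tdft R n p l).
Proof. exact: can_inj (@tdftK n p l). Qed.

Lemma ord_sub_inj l (j : 'I_l) : injective (fun k : 'I_l => ord_sub k j).
Proof.
move=> a b /(congr1 val) /= /eqP.
have jl := ltnW (ltn_ord j).
rewrite -!addnBA // eqn_modDr !modn_small // => /eqP; exact: val_inj.
Qed.

Lemma ord_negK l : involutive (@ord_neg l).
Proof.
move=> [[|k] kl]; apply: val_inj => /=.
  by rewrite subn0 modnn subn0 modnn.
by rewrite (modn_small (_ : l - k.+1 < l)%N) ?subKn ?modn_small //; lia.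
Qed.

Lemma tdft_prod n p q l (A : tensor (complex R) n p l) (B : tensor _ p q l) k :
  tdft (tprod A B) k = tdft A k *m tdft B k.
Proof.
have l0 := ord_pos k.
rewrite /tdft /tprod; under eq_bigr do rewrite scaler_sumr.
rewrite exchange_big /= mulmx_sumr; apply: eq_bigr => j _.
(* The cyclic shift by [j] matches the slices of [A]; the powers of [omega] then agree because
   exponents count modulo [l]. *)
rewrite [in RHS](reindex_inj (@ord_sub_inj l j)) /= mulmx_suml.
apply: eq_bigr => i _.
rewrite -scalemxAl -scalemxAr scalerA; congr (_ *: _).
rewrite -exprD -mulnDr ![(k * _)%N]mulnC !exprM; congr (_ ^+ _).
rewrite -[RHS](expr_mod _ (omega_l R l0)) modnDml subnK ?modnDr.
  by rewrite expr_mod // omega_l.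
by have := ltn_ord j; lia.
Qed.

Lemma tdft_add n p l (A B : tensor (complex R) n p l) k :
  tdft (tadd A B) k = tdft A k + tdft B k.
Proof. by rewrite /tdft -big_split; apply: eq_bigr => j _; rewrite scalerDr. Qed.

Lemma tliftE n p l (A : tensor R n p l) k : tlift A k = map_mx (real_complex R) (A k).
Proof. by []. Qed.

Lemma tlift_prod n p q l (A : tensor R n p l) (B : tensor R p q l) :
  tlift (tprod A B) = tprod (tlift A) (tlift B).
Proof.
apply/funext => k; rewrite tliftE /tprod map_mx_sum.
by apply: eq_bigr => j _; rewrite map_mxM.
Qed.

Lemma adjmxZ_real n p (t : R) (A : 'M[complex R]_(n, p)) :
  (t%:C%C *: A)^t* = t%:C%C *: A^t*.
Proof.
apply/matrixP => i j; rewrite !mxE rmorphM; congr (_ * _).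
by apply/eqP; rewrite eq_complex /= oppr0 !eqxx.
Qed.

Definition fslice n p l (A : tensor R n p l) (k : 'I_l) := tdft (tlift A) k.

Lemma fslice_inj n p l (A B : tensor R n p l) :
  (forall k, fslice A k = fslice B k) -> A = B.
Proof.
move=> e; have : tlift A = tlift B by apply/tdft_inj/funext.
move=> e'; apply: tensorP => k a b.
by have := congr1 (fun T : tensor _ n p l => T k a b) e'; rewrite !mxE => -[].
Qed.

Lemma fslice_prod n p q l (A : tensor R n p l) (B : tensor R p q l) k :
  fslice (tprod A B) k = fslice A k *m fslice B k.
Proof. by rewrite /fslice tlift_prod tdft_prod. Qed.

Lemma fslice_add n p l (A B : tensor R n p l) k :
  fslice (tadd A B) k = fslice A k + fslice B k.
Proof.
rewrite -tdft_add; congr tdft; apply: tensorP => j a b.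
by rewrite /tadd !tliftE !mxE rmorphD.
Qed.

Lemma fslice_sub n p l (A B : tensor R n p l) k :
  fslice (tsub A B) k = fslice A k - fslice B k.
Proof.
apply/eqP; rewrite eq_sym subr_eq -fslice_add; apply/eqP; congr fslice.
by apply: tensorP => j a b; rewrite !mxE subrK.
Qed.

Lemma fslice_scale n p l (t : R) (A : tensor R n p l) k :
  fslice (tscale t A) k = t%:C%C *: fslice A k.
Proof.
rewrite /fslice /tdft scaler_sumr; apply: eq_bigr => j _.
rewrite scalerA mulrC -scalerA; congr (_ *: _).
by apply/matrixP => a b; rewrite !tliftE !mxE rmorphM.
Qed.

Lemma fslice_id p l (k : 'I_l) : fslice (@tid R p l) k = 1%:M.
Proof.
have l0 := ord_pos k.
rewrite /fslice /tdft (bigD1 (Ordinal l0)) //= big1 ?addr0 => [|j j0].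
  by rewrite muln0 expr0 scale1r tliftE /tid /= map_mx1.
rewrite tliftE /tid ifN; first by rewrite map_mx0 scaler0.
by apply: contra j0 => /eqP j0; apply/eqP/val_inj.
Qed.

(** Negating the index inverts the powers of [omega], which for a root of unity is conjugation; the
    entries of [A] are real. *)
Lemma fslice_tr n p l (A : tensor R n p l) k : fslice (ttr A) k = (fslice A k)^t*.
Proof.
rewrite /fslice /tdft (reindex_inj (inv_inj (@ord_negK l))) /=.
apply/matrixP => a b; rewrite !mxE !summxE rmorph_sum; apply: eq_bigr => j _.
rewrite !tliftE !mxE omega_neg rmorphM ord_negK /= -conjcE omega_conj ?(ord_pos k) //.
by congr (_ * _); rewrite -conjcE conjc_real.
Qed.

Lemma fslice_neg n p l (A : tensor R n p l) k :
  fslice A (ord_neg k) = map_mx (@conjc R) (fslice A k).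
Proof.
rewrite /fslice /tdft; apply/matrixP => a b.
rewrite !mxE !summxE rmorph_sum; apply: eq_bigr => j _.
rewrite !tliftE !mxE mulnC omega_neg rmorphM /= omega_conj ?(ord_pos k) //.
by rewrite oppr0 mulnC.
Qed.

(** Converse of [fslice_neg]: conjugating the inverse DFT sum and replacing the index by its
    negative returns the same sum, so it is real and taking real parts loses nothing. *)
Lemma fslice_surj n p l (T : 'I_l -> 'M[complex R]_(n, p)) :
  (forall k, T (ord_neg k) = map_mx (@conjc R) (T k)) ->
  exists A : tensor R n p l, forall k, fslice A k = T k.
Proof.
move=> Tneg; exists (fun j => map_mx (@complex.Re R) (tidft T j)) => k.
rewrite /fslice -[in RHS](tidftK T); congr tdft; apply: tensorP => j a b.
rewrite tliftE 2!mxE; set z := tidft T j a b.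
have : conjc z = z; last first.
  case: z => x y [] /= /eqP.
  by rewrite eq_sym -addr_eq0 -mulr2n mulrn_eq0 => /eqP ->.
rewrite /z /tidft mxE summxE rmorphM rmorphV ?unitfE ?(natrl_neq0 j) //=.
rewrite rmorph_nat rmorph_sum; congr (_ * _).
rewrite [RHS](reindex_inj (inv_inj (@ord_negK l))) /=; apply: eq_bigr => i _.
rewrite [in RHS]mxE Tneg !mxE rmorphM; congr (_ * _).
by rewrite /= conjc_inv omega_conj ?(ord_pos j) // [in RHS]mulnC omega_neg mulnC.
Qed.

End Fourier.

(** * First-order expansions at 0 *)

Section Expansion.
Variable R : realType.
Local Notation K := (complex R).
Implicit Types (f g : R -> K) (a b c : K).

(** The bound [M] lives in [K] because complex norms do; [0 <= M] makes it real. *)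
Definition bigo k f := exists2 M : K, 0 <= M &
  \forall t \near (0 : R), `|f t| <= M * `|t%:C%C| ^+ k.

Lemma bigo_near k f g : (\forall t \near (0 : R), f t = g t) -> bigo k f -> bigo k g.
Proof.
by move=> fg [M M0 H]; exists M => //; apply: filterS2 fg H => t ->.
Qed.

Lemma bigo_ext k f g : f =1 g -> bigo k f -> bigo k g.
Proof. by move=> fg H; apply: (bigo_near _ H); exact: filterE. Qed.

Lemma bigoD k f g : bigo k f -> bigo k g -> bigo k (fun t => f t + g t).
Proof.
move=> [M M0 Hf] [N N0 Hg]; exists (M + N); first exact: addr_ge0.
apply: filterS2 Hf Hg => t Hf Hg; rewrite mulrDl.
exact: le_trans (ler_normD _ _) (lerD Hf Hg).
Qed.

Lemma bigoN k f : bigo k f -> bigo k (fun t => - f t).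
Proof. by move=> [M M0 H]; exists M => //; apply: filterS H => t; rewrite normrN. Qed.

Lemma bigoM j k f g : bigo j f -> bigo k g -> bigo (j + k) (fun t => f t * g t).
Proof.
move=> [M M0 Hf] [N N0 Hg]; exists (M * N); first exact: mulr_ge0.
apply: filterS2 Hf Hg => t Hf Hg; rewrite normrM exprD mulrACA.
by apply: ler_pM.
Qed.

Lemma near_small (d : R) : 0 < d -> \forall t \near (0 : R), `|t%:C%C| < d%:C%C.
Proof.
move=> d0; apply/nbhs_ballP; exists d => // t /=.
by rewrite /ball /= sub0r normrN normc_def /= expr0n addr0 sqrtr_sqr ltcR.
Qed.

Lemma bigo_le j k f : (k <= j)%N -> bigo j f -> bigo k f.
Proof.
move=> kj [M M0 H]; exists M => //.
apply: filterS2 (near_small ltr01) H => t t1 /le_trans; apply.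
by apply: ler_wpM2l => //; rewrite ler_wiXn2l // ltW.
Qed.

Lemma bigo_cst c : bigo 0 (fun=> c).
Proof. by exists `|c| => //; apply: filterE => t; rewrite expr0 mulr1. Qed.

Lemma bigo_id : bigo 1 (fun t => t%:C%C).
Proof. by exists 1 => //; apply: filterE => t; rewrite expr1 mul1r. Qed.

Lemma bigo_conj k f : bigo k f -> bigo k (fun t => conjc (f t)).
Proof. by move=> [M M0 H]; exists M => //; apply: filterS H => t; rewrite normcJ. Qed.

(** Expansion $f(t) = a + tb + O(t^2)$: asking for a quadratic remainder instead of $o(t)$ reduces
    the calculus of expansions to products of bounds. *)
Definition dev f a b := bigo 2 (fun t => f t - (a + t%:C%C * b)).

Lemma dev_ext f g a b : f =1 g -> dev f a b -> dev g a b.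
Proof. by move=> fg; apply: bigo_ext => t; rewrite fg. Qed.

Lemma dev_bounded f a b : dev f a b -> bigo 0 f.
Proof.
move=> /(bigo_le (leq0n _)) H.
have := bigoD H (bigoD (bigo_cst a) (bigo_le (leq0n _) (bigoM bigo_id (bigo_cst b)))).
by apply: bigo_ext => t; rewrite subrK.
Qed.

Lemma dev_lin f a b : dev f a b -> bigo 1 (fun t => f t - a).
Proof.
move=> /(bigo_le (leqnSn _)) H; have := bigoD H (bigoM bigo_id (bigo_cst b)).
by apply: bigo_ext => t; rewrite opprD addrA subrK.
Qed.

Lemma dev_affine a b : dev (fun t => a + t%:C%C * b) a b.
Proof.
exists 0 => //; apply: filterE => t; by rewrite subrr normr0 mul0r.
Qed.

Lemma dev_cst a : dev (fun=> a) a 0.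
Proof. by apply: dev_ext (dev_affine a 0) => t; rewrite mulr0 addr0. Qed.

Lemma devD f g a b a' b' : dev f a b -> dev g a' b' ->
  dev (fun t => f t + g t) (a + a') (b + b').
Proof. by move=> F G; apply: bigo_ext (bigoD F G) => t; ring. Qed.

Lemma devN f a b : dev f a b -> dev (fun t => - f t) (- a) (- b).
Proof. by move=> F; apply: bigo_ext (bigoN F) => t; ring. Qed.

Lemma devM f g a b a' b' : dev f a b -> dev g a' b' ->
  dev (fun t => f t * g t) (a * a') (a * b' + b * a').
Proof.
move=> F G.
(* The remainder splits as $(f-a-tb)g + (a+tb)(g-a'-tb') + t^2bb'$. *)
have H1 := bigoM F (dev_bounded G).
have H2 := bigoM (dev_bounded (dev_affine a b)) G.
have H3 := bigoM (bigoM bigo_id bigo_id) (bigo_cst (b * b')).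
by apply: bigo_ext (bigoD (bigoD H1 H2) H3) => t; ring.
Qed.

Lemma devZ c f a b : dev f a b -> dev (fun t => c * f t) (c * a) (c * b).
Proof. by move=> /(devM (dev_cst c)); rewrite mul0r addr0. Qed.

Lemma dev_sum (I : finType) (P : pred I) (f : I -> R -> K) (a b : I -> K) :
  (forall i, P i -> dev (f i) (a i) (b i)) ->
  dev (fun t => \sum_(i | P i) f i t) (\sum_(i | P i) a i) (\sum_(i | P i) b i).
Proof.
move=> H; rewrite unlock /=; elim: (index_enum I) => [|i r IH] /=.
  exact: dev_cst.
by case: ifP => // Pi; apply: devD => //; exact: H.
Qed.

Lemma dev_conj f a b : dev f a b -> dev (fun t => conjc (f t)) (conjc a) (conjc b).
Proof.
move=> /bigo_conj; apply: bigo_ext => t.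
by rewrite rmorphB rmorphD rmorphM /= oppr0.
Qed.

(** Near 0 the inverse is bounded, and $f^{-1} - (1-tb) = f^{-1}(t^2b^2 - (f-1-tb)(1-tb))$. *)
Lemma dev_inv f b : dev f 1 b -> dev (fun t => (f t)^-1) 1 (- b).
Proof.
move=> F; have [M M0 HM] := dev_lin F.
have [d d0 dM] : exists2 d : R, 0 < d & M * d%:C%C <= 2^-1.
  case: M M0 {HM} => x y; rewrite lecE /= => /andP[/eqP -> x0].
  (* [M] is the real number [x]; the [+ 1] covers [x = 0]. For [t] smaller than [d], [f t] is within
     1/2 of 1. *)
  exists (2 * (x + 1))^-1; first by rewrite invr_gt0 mulr_gt0 // ltr_wpDl.
  have -> : (2^-1 : K) = (2^-1)%:C%C by rewrite fmorphV rmorph_nat.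
  rewrite -[Complex x 0]/(x%:C%C) -rmorphM lecR invfM mulrCA ger_pMr ?invr_gt0 //.
  by rewrite ler_pdivrMr ?ltr_wpDl // mul1r lerDl.
have near_half : \forall t \near (0 : R), 2^-1 <= `|f t|.
  apply: filterS2 HM (near_small d0) => t; rewrite expr1 => H1 H2.
  have H3 : `|f t - 1| <= 2^-1.
    by rewrite (le_trans H1) // (le_trans _ dM) // ler_wpM2l // ltW.
  have := ler_distD (f t) 1 0; rewrite subr0 normr1 subr0 distrC => H4.
  rewrite -(lerD2l 2^-1); have -> : 2^-1 + 2^-1 = 1 :> K by field.
  by rewrite (le_trans H4) // lerD2r.
have inv_bd : bigo 0 (fun t => (f t)^-1).
  exists 2 => //; apply: filterS near_half => t H; rewrite expr0 mulr1 normfV.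
  by rewrite -[leRHS]invrK lef_pV2 // posrE ?invr_gt0 // (lt_le_trans _ H) ?invr_gt0.
have H1 := bigoM inv_bd (bigoM (bigoM bigo_id bigo_id) (bigo_cst (b * b))).
have H2 := bigoM inv_bd (bigoM F (dev_bounded (dev_affine 1 (- b)))).
apply: bigo_near (bigoD H1 (bigoN H2)); apply: filterS near_half => t H.
have f0 : f t != 0 by rewrite -normr_gt0 (lt_le_trans _ H) ?invr_gt0.
by field.
Qed.

(** First $f-1 = (f^2-1)/(f+1)$ is $O(t)$, as $f+1 \ge 1$; then $f-1-tb/2 = \frac12((f^2-1-tb) -
    (f-1)^2)$. *)
Lemma dev_sqrt f b : (forall t, 0 < f t) -> dev (fun t => f t ^+ 2) 1 b ->
  dev f 1 (b / 2).
Proof.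
move=> f0 F.
have f1 t : 1 <= f t + 1 by rewrite lerDr ltW.
have f1' t : f t + 1 != 0 by rewrite gt_eqF // (lt_le_trans ltr01).
have inv_bd : bigo 0 (fun t => (f t + 1)^-1).
  exists 1 => //; apply: filterE => t; rewrite expr0 mulr1 normfV.
  by rewrite invf_le1 ger0_norm ?(le_trans ler01) // (lt_le_trans ltr01).
have L : bigo 1 (fun t => f t - 1).
  apply: bigo_ext (bigoM inv_bd (dev_lin F)) => t.
  by field.
have H := bigoM (bigo_cst 2^-1) (bigoD F (bigoN (bigoM L L))).
by apply: bigo_ext H => t; field.
Qed.

Lemma is_derive_quadratic (h : R -> R) (d M : R) : 0 <= M ->
  (\forall t \near (0 : R), `|h t - h 0 - t * d| <= M * `|t| ^+ 2) ->
  is_derive (0 : R) (1 : R) h d.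
Proof.
move=> M0 H.
have cv : ((fun x : R => x^-1 *: ((h \o shift 0) (x *: (1 : R)) - h 0)) @ (0 : R)^'
    --> d)%classic.
  apply/cvgrPdist_le => e e0.
  have M1 : 0 < M + 1 by rewrite ltr_wpDl.
  have small := dnbhs0_le (V := R) (divr_gt0 e0 M1).
  apply: filterS3 (nbhs_dnbhs H) small (nbhs_dnbhs_neq (0 : R)) => x Hx xe x0 /=.
  have xn0 : 0 < `|x| by rewrite normr_gt0.
  rewrite addr0 [x *: 1]mulr1 [x^-1 *: _]/(x^-1 * _).
  have -> : d - x^-1 * (h x - h 0) = - (x^-1 * (h x - h 0 - x * d)) by field.
  rewrite normrN normrM normfV ler_pdivrMl // (le_trans Hx) //.
  rewrite expr2 mulrCA ler_pM2l // (le_trans (ler_wpM2l M0 xe)) //.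
  by rewrite mulrCA ger_pMr // ler_pdivrMr // mul1r lerDl.
split; first by apply/cvg_ex; exists d.
exact: cvg_lim cv.
Qed.

Lemma dev_real (g : R -> R) a b : dev (fun t => (g t)%:C%C) a b ->
  b = (complex.Re b)%:C%C /\ is_derive (0 : R) (1 : R) g (complex.Re b).
Proof.
move=> [[x y]]; rewrite lecE /= => /andP[/eqP -> x0 H] {y}.
(* At [t = 0] the bound reads $|g(0)-a| \le 0$. *)
have H0 : a = (g 0)%:C%C.
  have := nbhs_singleton H; rewrite mul0r addr0 normr0 expr0n mulr0.
  by rewrite normr_le0 subr_eq0 => /eqP.
have E t : (g t)%:C%C - (a + t%:C%C * b) =
    Complex (g t - g 0 - t * complex.Re b) (- (t * complex.Im b)).
  rewrite H0; case: b {H} => u v; apply/eqP; rewrite eq_complex /=.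
  by apply/andP; split; apply/eqP; ring.
have B t : `|(g t)%:C%C - (a + t%:C%C * b)| <= Complex x 0 * `|t%:C%C| ^+ 2 ->
    `|g t - g 0 - t * complex.Re b| <= x * `|t| ^+ 2 /\
    `|t * complex.Im b| <= x * `|t| ^+ 2.
  rewrite E; set u := _ - t * _; set v := t * _.
  have -> : Complex x 0 * `|t%:C%C| ^+ 2 = (x * `|t| ^+ 2)%:C%C.
    by rewrite normc_def /= expr0n addr0 sqrtr_sqr rmorphM rmorphXn.
  rewrite normc_def /= lecR sqrrN => le.
  split; apply: le_trans le; rewrite -sqrtr_sqr ler_sqrt ?addr_ge0 ?sqr_ge0 //.
    by rewrite lerDl sqr_ge0.
  by rewrite lerDr sqr_ge0.
have D1 : is_derive (0 : R) (1 : R) g (complex.Re b).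
  by apply: (is_derive_quadratic x0); apply: filterS H => t /B[].
(* Since [g] is real, the imaginary part of the remainder is [- (t * Im b)]; its quadratic bound
   makes [Im b] the derivative of the zero function, hence 0. *)
have D2 : is_derive (0 : R) (1 : R) (fun=> 0 : R) (complex.Im b).
  apply: (is_derive_quadratic x0); apply: filterS H => t /B[_].
  by rewrite subrr sub0r normrN.
split=> //; case: b {H E B D1} D2 => u v /= D2.
have := @derive_val _ _ _ _ _ _ _ D2; by rewrite derive_cst => <-.
Qed.

End Expansion.

(** * First-order expansion of the QR factors along a line of matrices *)

Section QRDerivative.
Variable R : realType.
Local Notation K := (complex R).
Implicit Types n p : nat.

(** First-order analogue of [cholesky_uniq], again row by row: a square root gives the diagonal
    entry and a division gives the entries to its right. *)
Lemma dev_cholesky p (S : R -> 'M[K]_p) (T : 'M[K]_p) :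
  (forall t, upper_pos (S t)) ->
  (forall a b : 'I_p, (b < a)%N -> T a b = 0) ->
  (forall a, (T^t*) a a = T a a) ->
  (forall a b, dev (fun t => ((S t)^t* *m S t) a b) ((1%:M : 'M[K]_p) a b)
    ((T^t* + T) a b)) ->
  forall a b, dev (fun t => S t a b) ((1%:M : 'M[K]_p) a b) (T a b).
Proof.
move=> uS Tu Tr G.
suff H m : forall a b : 'I_p, (a < m)%N ->
    dev (fun t => S t a b) ((1%:M : 'M[K]_p) a b) (T a b).
  by move=> a b; exact: (H a.+1).
elim: m => // m IH a b; rewrite ltnS => am.
have P (c : 'I_p) : (a <= c)%N -> dev (fun t => S t a a * S t a c) ((1%:M : 'M[K]_p) a c)
    ((T^t* + T) a c).
  move=> ac.
  (* Both factors are off-diagonal entries of earlier rows with constant term 0, so the products are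
     $O(t^2)$. *)
  have D : dev (fun t => \sum_(d < p | (d < a)%N) Num.conj (S t d a) * S t d c) 0 0.
    have := dev_sum (P := fun d : 'I_p => (d < a)%N)
      (fun d da => devM (dev_conj (IH d a (leq_trans da am)))
        (IH d c (leq_trans da am))).
    rewrite !big1 // => d da; rewrite !mxE -!val_eqE /=;
      rewrite (ltn_eqF da) (ltn_eqF (leq_trans da ac)).
      by rewrite /= oppr0 mulr0 mul0r addr0.
    by rewrite mulr0.
  have := devD (G a c) (devN D); rewrite oppr0 !addr0; apply: dev_ext => t.
  by rewrite upper_gramE // addrK.
have Daa : dev (fun t => S t a a) 1 (T a a).
  have -> : T a a = (T^t* + T) a a / 2 by rewrite [in RHS]mxE Tr; field.
  apply: dev_sqrt => [t|]; first by case: (uS t).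
  by have := P a (leqnn a); rewrite [(1%:M : 'M[K]_p) a a]mxE eqxx.
case: (ltngtP b a) => [ba|ab|/val_inj ->].
- rewrite Tu // mxE -val_eqE /= gtn_eqF //; apply: dev_ext (dev_cst 0) => t.
  by case: (uS t) => ->.
- have := devM (dev_inv Daa) (P b (ltnW ab)).
  rewrite !mxE -val_eqE /= ltn_eqF // Tu // conjC0 !mulr0 !mul1r add0r addr0.
  apply: dev_ext => t; case: (uS t) => _ /(_ a) Sa.
  by rewrite mulKf // gt_eqF.
- by rewrite mxE eqxx.
Qed.

(** Substitution column by column: entry [b] of a row of [Q t] is that of $Q_0 + tC$ minus the terms
    from columns before [b], divided by [S t b b]. *)
Lemma dev_upper_solve n p (Q : R -> 'M[K]_(n, p)) (S : R -> 'M[K]_p)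
    (Q0 C : 'M[K]_(n, p)) (T : 'M[K]_p) :
  (forall t, upper_pos (S t)) ->
  (forall a b : 'I_p, (b < a)%N -> T a b = 0) ->
  (forall a b, dev (fun t => S t a b) ((1%:M : 'M[K]_p) a b) (T a b)) ->
  (forall t, Q t *m S t = Q0 + t%:C%C *: C) ->
  forall a b, dev (fun t => Q t a b) (Q0 a b) ((C - Q0 *m T) a b).
Proof.
move=> uS Tu DS QS a.
suff H m : forall b : 'I_p, (b < m)%N ->
    dev (fun t => Q t a b) (Q0 a b) ((C - Q0 *m T) a b).
  by move=> b; exact: (H b.+1).
elim: m => // m IH b; rewrite ltnS => bm.
have D := dev_sum (P := fun d : 'I_p => (d < b)%N)
  (fun d db => devM (IH d (leq_trans db bm)) (DS d b)).
have Dbb : dev (fun t => S t b b) 1 (T b b) by have := DS b b; rewrite mxE eqxx.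
have := devM (devD (dev_affine (Q0 a b) (C a b)) (devN D)) (dev_inv Dbb).
rewrite [X in Q0 a b - X]big1 => [|c cb]; last first.
  by rewrite mxE -val_eqE /= ltn_eqF // mulr0.
rewrite (eq_bigr (fun c => Q0 a c * T c b)) => [|c cb]; last first.
  by rewrite [(1%:M : 'M[K]_p) c b]mxE -val_eqE /= ltn_eqF // mulr0 addr0.
rewrite subr0 !mulr1 mxE [(- (Q0 *m T)) a b]mxE mul_upperE //.
set s := \sum_(c < p | _) _; have -> : Q0 a b * - T b b + (C a b - s) =
  C a b - (Q0 a b * T b b + s) by ring.
apply: dev_ext => t; case: (uS t) => Su /(_ b) Sb.
have := mul_upperE (Q t) a b Su; rewrite QS !mxE => ->.
by rewrite addrK mulfK // gt_eqF.
Qed.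


(** With [sub_Pskew_upper] and [sub_Pskew_diag], this gives the properties by which the theorem
    describes [Pskew]. *)
Lemma adj_Pskew p (B : 'M[K]_p) : (Pskew B)^t* = - Pskew B.
Proof.
apply/matrixP => a b; rewrite !mxE -!val_eqE /=.
case: (ltngtP b a) => [ba|ab|/val_inj ->].
- by rewrite rmorphN /= -conjcE conjcK.
- by rewrite opprK.
- by rewrite -conjcE; apply/eqP; rewrite eq_complex /= oppr0 !eqxx.
Qed.

Lemma sub_Pskew_upper p (B : 'M[K]_p) (a b : 'I_p) : (b < a)%N ->
  (B - Pskew B) a b = 0.
Proof. by move=> ba; rewrite !mxE ba subrr. Qed.

Lemma sub_Pskew_diag p (B : 'M[K]_p) a :
  ((B - Pskew B)^t*) a a = (B - Pskew B) a a.
Proof.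
rewrite !mxE ltnn eqxx -conjcE; case: (B a a) => x y.
by apply/eqP; rewrite eq_complex /= subrr oppr0 !eqxx.
Qed.

(* Writing [Q0 + t C = Q(t) S(t)], the factor [S] satisfies
   [S^* S = 1 + t (B^* + B) + O(t^2)], so [S'(0)] is the upper triangular matrix
   with real diagonal and Hermitian part that of [B], namely [B - Pskew B]. *)
Lemma dev_qr n p (Q : R -> 'M[K]_(n, p)) (S : R -> 'M[K]_p) (Q0 C : 'M[K]_(n, p)) :
  (forall t, (Q t)^t* *m Q t = 1%:M) -> (forall t, upper_pos (S t)) ->
  Q0^t* *m Q0 = 1%:M ->
  (forall t, Q t *m S t = Q0 + t%:C%C *: C) ->
  forall a b, dev (fun t => Q t a b) (Q0 a b)
    ((Q0 *m Pskew (Q0^t* *m C) + (1%:M - Q0 *m Q0^t*) *m C) a b).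
Proof.
move=> Q1 uS Q01 QS a b; set B := Q0^t* *m C.
have -> : Q0 *m Pskew B + (1%:M - Q0 *m Q0^t*) *m C = C - Q0 *m (B - Pskew B).
  rewrite mulmxBl mul1mx mulmxBr opprB mulmxA -/B addrC -addrA [- _ + _]addrC.
  by rewrite /B -!mulmxA.
have Tu := @sub_Pskew_upper p B.
apply: (dev_upper_solve uS Tu _ QS); apply: dev_cholesky => // {a b}.
  exact: sub_Pskew_diag.
move=> a b.
have -> : (B - Pskew B)^t* + (B - Pskew B) = B^t* + B.
  have /eqP := adj_Pskew B; rewrite -addr_eq0 => /eqP e.
  apply/esym; rewrite -[B in LHS](subrK (Pskew B)) adjmxD.
  by rewrite addrACA e addr0.
(* The Gram matrix of $Q_0 + tC$ is exactly quadratic in [t], with remainder $t^2 C^* C$. *)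
have H := bigoM (bigoM (bigo_id R) (bigo_id R)) (bigo_cst ((C^t* *m C) a b)).
apply: bigo_ext H => t.
rewrite -(isometry_gram (S t) (Q1 t)) QS adjmxD adjmxZ_real.
rewrite mulmxDl !mulmxDr Q01 -!scalemxAl -!scalemxAr -/B.
have -> : C^t* *m Q0 = B^t* by rewrite adjmxM adjmxK.
clear Tu; move: B (B^t*) (C^t* *m C) (1%:M : 'M[K]_p) => M1 M2 M3 M4.
by rewrite !mxE; ring.
Qed.

End QRDerivative.

(** * The t-QR factorization *)

Section TensorQR.
Variable R : realType.
Local Notation K := (complex R).
Implicit Types n p l : nat.

Lemma upper_pos_diagP p (M : 'M[K]_p) : upper_pos_diag M <-> upper_pos M.
Proof.
split=> -[Mu Md]; split=> // a; have := Md a; rewrite ltcE.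
  by move=> [-> ->]; rewrite eqxx.
by move=> /andP[/eqP -> ->].
Qed.

Lemma tStiefelP n p l (X : tensor R n p l) :
  tStiefel X <-> forall k, (fslice X k)^t* *m fslice X k = 1%:M.
Proof.
split=> [H k|H]; first by rewrite -fslice_tr -fslice_prod H fslice_id.
by apply: fslice_inj => k; rewrite fslice_prod fslice_tr H fslice_id.
Qed.

(** On each slice, tangency is the vanishing of the cross terms $X^* U + U^* X$. *)
Lemma tTangent_gram n p l (X U : tensor R n p l) k : tStiefel X -> tTangent X U ->
  (fslice (tadd X U) k)^t* *m fslice (tadd X U) k
  = 1%:M + (fslice U k)^t* *m fslice U k.
Proof.
move=> /tStiefelP X1 XU; rewrite fslice_add adjmxD mulmxDl !mulmxDr X1.
have e : (fslice X k)^t* *m fslice U k + (fslice U k)^t* *m fslice X k = 0.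
  rewrite -!fslice_tr -!fslice_prod -fslice_add XU /fslice /tdft big1 // => j _.
  by rewrite tliftE map_mx0 scaler0.
by rewrite addrA -(addrA 1%:M) e addr0.
Qed.

(** This provides a t-QR factorization of $X+U+tV$ for every real [t], as [dev_qr] asks, and not
    only near 0. *)
Lemma tTangent_line n p l (X U V : tensor R n p l) (t : R) :
  tTangent X U -> tTangent X V -> tTangent X (tadd U (tscale t V)).
Proof.
have slice W : tTangent X W <-> forall k,
    (fslice X k)^t* *m fslice W k + (fslice W k)^t* *m fslice X k = 0.
  have F0 k : fslice ((fun=> 0) : tensor R p p l) k = 0.
    by rewrite /fslice /tdft big1 // => j _; rewrite tliftE map_mx0 scaler0.
  split=> [H k|H].
    by rewrite -!fslice_tr -!fslice_prod -fslice_add H F0.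
  by apply: fslice_inj => k; rewrite F0 fslice_add !fslice_prod !fslice_tr.
move=> /slice XU /slice XV; apply/slice => k.
rewrite fslice_add fslice_scale adjmxD adjmxZ_real.
rewrite mulmxDr mulmxDl addrACA XU add0r -scalemxAr -scalemxAl -scalerDr XV.
by rewrite scaler0.
Qed.

Lemma is_tQR_exists n p l (A : tensor R n p l) : (p <= n)%N ->
  (forall k, (fslice A k)^t* *m fslice A k \in unitmx) ->
  exists Q Rt, is_tQR A Q Rt.
Proof.
move=> pn Au.
have /choice[f Hf] : forall k, exists QS : 'M[K]_(n, p) * 'M[K]_p,
    [/\ QS.1^t* *m QS.1 = 1%:M, upper_pos QS.2 & fslice A k = QS.1 *m QS.2].
  by move=> k; have [Q [S H]] := qr_exists pn (Au k); exists (Q, S).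
have conj_adj q r (M : 'M[K]_(q, r)) :
    (map_mx (@conjc R) M)^t* = map_mx (@conjc R) (M^t*).
  by apply/matrixP => a b; rewrite !mxE.
(* The slicewise factors are chosen independently; uniqueness of QR forces the conjugate symmetry
   that [fslice_surj] requires. *)
have Hneg k : (f (ord_neg k)).1 = map_mx (@conjc R) (f k).1 /\
    (f (ord_neg k)).2 = map_mx (@conjc R) (f k).2.
  have [Q1 S1 e1] := Hf (ord_neg k); have [Q2 S2 e2] := Hf k.
  apply: qr_uniq => //.
  - by rewrite conj_adj -map_mxM Q2 map_mx1.
  - case: S2 => Su Sp; split=> [a b ba|a]; rewrite mxE; first by rewrite Su // rmorph0.
    by rewrite conjcE (CrealP _) ?gtr0_real.
  - by rewrite -e1 fslice_neg e2 map_mxM.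
have [Q HQ] := fslice_surj (fun k => proj1 (Hneg k)).
have [S HS] := fslice_surj (fun k => proj2 (Hneg k)).
exists Q, S; split; [|split].
- by apply/tStiefelP => k; rewrite HQ; case: (Hf k).
- by apply: fslice_inj => k; rewrite fslice_prod HQ HS; case: (Hf k).
- by move=> k; apply/upper_pos_diagP; rewrite -/(fslice S k) HS; case: (Hf k).
Qed.

Lemma qf_is_tQR n p l (A : tensor R n p l) :
  (exists Q Rt, is_tQR A Q Rt) -> exists Rt, is_tQR A (qf A) Rt.
Proof. by rewrite /qf; case: pselect => // e _; case: cid. Qed.

Lemma fslice_tinv p l (A : tensor R p p l) k :
  (forall k, fslice A k \in unitmx) -> fslice (tinv A) k = invmx (fslice A k).
Proof.
move=> Au.
have [B HB] : exists B : tensor R p p l, forall k, fslice B k = invmx (fslice A k).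
  by apply: fslice_surj => j; rewrite fslice_neg map_invmx.
(* This excludes the default branch of [tinv]. *)
have e : exists B, tprod A B = @tid R p l /\ tprod B A = @tid R p l.
  by exists B; split; apply: fslice_inj => j;
    rewrite fslice_prod HB fslice_id ?mulmxV ?mulVmx.
rewrite /tinv; case: pselect => // e'; case: cid => C /= [AC _].
have : fslice A k *m fslice C k = 1%:M by rewrite -fslice_prod AC fslice_id.
by move=> H; rewrite -[LHS](mulKmx (Au k)) H mulmx1.
Qed.

Lemma dev_tidft n p l (T : R -> tensor K n p l) (T0 T1 : tensor K n p l) :
  (forall k a b, dev (fun t => T t k a b) (T0 k a b) (T1 k a b)) ->
  forall k a b, dev (fun t => tidft (T t) k a b) (tidft T0 k a b) (tidft T1 k a b).
Proof.
move=> H k a b.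
have E (S : tensor K n p l) : tidft S k a b =
    l%:R^-1 * \sum_(i < l) (omega R l ^+ (i * k))^-1 * S i a b.
  by rewrite /tidft mxE summxE; congr (_ * _); apply: eq_bigr => i _; rewrite mxE.
rewrite !E; apply: dev_ext (fun t => esym (E (T t))) _.
by apply: devZ; apply: dev_sum => i _; apply: devZ.
Qed.

End TensorQR.

(** * The differentiated t-QR retraction *)

Theorem mainTheorem11 (R : realType) (n p l : nat) (X U V : tensor R n p l) :
  (p <= n)%N -> tStiefel X -> tTangent X U -> tTangent X V ->
  let Q := qf (tadd X U) in
  let C := tprod V (tinv (tprod (ttr Q) (tadd X U))) in
  let B := tprod (ttr Q) C in
  exists D : tensor R n p l,
    (forall (k : 'I_l) (a : 'I_n) (b : 'I_p),
        is_derive (0 : R) (1 : R)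
          (fun t : R => qf (tadd X (tadd U (tscale t V))) k a b) (D k a b)) /\
    tlift D =
      tadd (tprod (tlift Q) (tidft (fun k => Pskew (tdft (tlift B) k))))
           (tlift (tprod (tsub (@tid R n l) (tprod Q (ttr Q))) C)).
Proof.
move=> pn X1 XU XV Q C B.
pose A t := tadd X (tadd U (tscale t V)).
have /choice[S HS] t : exists Rt, is_tQR (A t) (qf (A t)) Rt.
  apply: qf_is_tQR; apply: is_tQR_exists => // k.
  by rewrite (tTangent_gram _ X1 (tTangent_line t XU XV)) add1_gram_unit.
have A0 : A 0 = tadd X U.
  by apply: tensorP => k a b; rewrite /A /tadd /tscale !mxE mul0r addr0.
have Q1 t k : (fslice (qf (A t)) k)^t* *m fslice (qf (A t)) k = 1%:M.
  by have [/tStiefelP] := HS t.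
have uS t k : upper_pos (fslice (S t) k).
  by have [_ [_ H]] := HS t; apply/upper_pos_diagP; exact: H.
have QS t k : fslice (qf (A t)) k *m fslice (S t) k = fslice (A t) k.
  by have [_ [e _]] := HS t; rewrite -fslice_prod -e.
(* The tensor inverted in [C] is the R-factor at [t = 0], so it is invertible on every slice. *)
have Rk k : fslice (tprod (ttr Q) (tadd X U)) k = fslice (S 0) k.
  by rewrite fslice_prod fslice_tr /Q -A0 -QS mulmxA Q1 mul1mx.
have Ck k : fslice C k = fslice V k *m invmx (fslice (S 0) k).
  rewrite fslice_prod fslice_tinv ?Rk // => j.
  by rewrite Rk upper_unit.
pose Dh : tensor (complex R) n p l := fun k =>
  fslice Q k *m Pskew (fslice B k) +
  (1%:M - fslice Q k *m (fslice Q k)^t*) *m fslice C k.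
have DQ k a b : dev (fun t => fslice (qf (A t)) k a b) (fslice Q k a b) (Dh k a b).
  rewrite /Dh /B fslice_prod fslice_tr.
  (* Right division by the R-factor at 0 turns $X+U+tV$ into $Q+tC$ and keeps the triangular factor
     upper triangular with positive diagonal. *)
  apply: (dev_qr (S := fun t => fslice (S t) k *m invmx (fslice (S 0) k))) => //.
  - move=> t; apply: (upper_pos_divr (uS 0 k) (uS t k)).
    by rewrite mulmxKV ?upper_unit.
  - by rewrite /Q -A0.
  - move=> t; rewrite mulmxA QS Ck /A !fslice_add fslice_scale addrA mulmxDl.
    by rewrite -fslice_add -A0 -QS mulmxK ?upper_unit // /Q -A0 scalemxAl.
have DR k a b : tidft Dh k a b = (complex.Re (tidft Dh k a b))%:C%C /\
  is_derive (0 : R) (1 : R) (fun t => qf (A t) k a b) (complex.Re (tidft Dh k a b)).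
  have H := dev_tidft DQ k a b.
  apply: dev_real (dev_ext _ H) => t.
  by rewrite (tdftK (tlift (qf (A t)))) tliftE mxE.
(* By [DR] the inverse DFT of [Dh] is already real, so [D] lifts back to it and the formula can be
   checked slicewise after the DFT. *)
exists (fun k => map_mx (@complex.Re R) (tidft Dh k)); split=> [k a b|].
  by rewrite mxE; case: (DR k a b).
transitivity (tidft Dh).
  apply: tensorP => k a b; rewrite tliftE 2!mxE.
  by case: (DR k a b) => e _; exact/esym.
apply: (@tdft_inj R n p l); apply/funext => k.
rewrite tidftK tdft_add tdft_prod tidftK -/(fslice (tprod _ C) k) -/(fslice Q k).
by rewrite fslice_prod fslice_sub fslice_id fslice_prod fslice_tr.
Qed.
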